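(* Let $K=\overline{\mathbb Q}$ and let $r,s,u\in K$ be such that the plane quartic $X_4: x^4+y^4+z^4+rx^2y^2+sy^2z^2+uz^2x^2=0$ is smooth. Let $$p=\frac{\sqrt{-\sqrt{r^2-4}-r}}{\sqrt2},\qquad q=\frac{\sqrt{\sqrt{r^2-4}-r}}{\sqrt2},$$ with square roots chosen so that $pq=1$ (thus $p^2+q^2=-r$). Then the system of equations \begin{align*} &(b^2-e^2)(q+p)+(c^2-d^2)(q-p)=0,\\ &a^2q^2-b^2+c^2+d^2-e^2+f^2p^2=s,\\ &f^2+e^2+d^2+c^2+b^2+a^2=-u,\\ &adeq-abcq+cefp-bdfp=0,\\ &cef+bdf+ade+abc=0,\\ &a^2f^2-2abef-2acdf+b^2e^2-2bcde+c^2d^2=1 \end{align*} in the six unknowns $a,b,c,d,e,f$ has a symbolic solution, i.e. a solution $(a,b,c,d,e,f)\in K^6$ all of whose entries are expressible by radicals in terms of $r,s,u$.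
   Context: An element of $K$ is expressible by radicals in terms of $r,s,u$ if it lies in a field $F_m\subset K$ at the top of a tower $\mathbb Q(r,s,u)=F_0\subset F_1\subset\cdots\subset F_m$ with $F_{i+1}=F_i(t_i)$ and $t_i^{n_i}\in F_i$ for some $n_i\geq 1$. *)

(* Defs.v *)
From HB Require Import structures.
From mathcomp Require Import all_boot all_order all_algebra all_field.
From mathcomp Require Import mpoly.

Set Implicit Arguments.
Unset Strict Implicit.
Unset Printing Implicit Defensive.

Import Order.TTheory GRing.Theory Num.Theory.
Local Open Scope ring_scope.

Definition is_subfield (F : algC -> Prop) : Prop :=
  [/\ F 1,
      forall x y, F x -> F y -> F (x - y)
    & forall x y, F x -> F y -> F (x / y)].

(* The intersection of all subfields containing S; as every subfield contains
   the rationals, this is Q(S). *)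
Definition gen_subfield (S : algC -> Prop) : algC -> Prop :=
  fun x => forall F : algC -> Prop,
    is_subfield F -> (forall y, S y -> F y) -> F x.

Definition adjoin (F : algC -> Prop) (t : algC) : algC -> Prop :=
  gen_subfield (fun x => F x \/ x = t).

Definition expressible_by_radicals (r s u x : algC) : Prop :=
  exists (m : nat) (F : nat -> algC -> Prop) (t : nat -> algC) (n : nat -> nat),
    [/\ forall y, F 0%N y <-> gen_subfield (fun z => [\/ z = r, z = s | z = u]) y,
        forall i, (i < m)%N ->
          [/\ (1 <= n i)%N,
              F i (t i ^+ n i)
            & forall y, F i.+1 y <-> adjoin (F i) (t i) y]
      & F m x].

Definition quartic_X4 (r s u : algC) : {mpoly algC[3]} :=
  let x : {mpoly algC[3]} := 'X_0 in
  let y : {mpoly algC[3]} := 'X_1 in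
  let z : {mpoly algC[3]} := 'X_2 in
  x ^+ 4 + y ^+ 4 + z ^+ 4
  + r *: (x ^+ 2 * y ^+ 2) + s *: (y ^+ 2 * z ^+ 2) + u *: (z ^+ 2 * x ^+ 2).

(* Jacobian criterion at every point of the projective plane over the
   algebraically closed field algC; P is meant to be homogeneous. *)
Definition smooth_plane_curve (P : {mpoly algC[3]}) : Prop :=
  forall v : 'I_3 -> algC,
    (exists i, v i != 0) -> P.@[v] = 0 -> exists i, (P^`M(i)).@[v] != 0.

(* Main.v *)
Require Import Defs.
From HB Require Import structures.
From mathcomp Require Import all_boot all_order all_algebra all_field.
From mathcomp Require Import mpoly.
From mathcomp Require Import ring.

(* The left-hand side of the last equation is the determinant of the symmetric
   4x4 matrix with zero diagonal and off-diagonal entries a, ..., f.  For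
   a = f = 0 the fourth and fifth equations are trivial and the last one reads
   (be - cd)^2 = 1.  Put b^2 - e^2 = (q - p) k and c^2 - d^2 = - (q + p) k, so
   that the first equation holds; the second and third prescribe b^2 + e^2 and
   c^2 + d^2.  Imposing be - cd = 1 then gives be = (1 + su/4 + k^2) / 2, and
   the only remaining condition is a quadratic equation in k^2. *)

Set Implicit Arguments.
Unset Strict Implicit.
Unset Printing Implicit Defensive.

Import Order.TTheory GRing.Theory Num.Theory.
Local Open Scope ring_scope.

(** * Closure properties of subfields of K *)

Section Subfield.
Variable F : algC -> Prop.
Hypothesis subF : is_subfield F.

Lemma subfield1 : F 1. Proof. by case: subF. Qed.

Lemma subfieldB x y : F x -> F y -> F (x - y).
Proof. by case: subF => _ + _; apply. Qed.

Lemma subfield_div x y : F x -> F y -> F (x / y).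
Proof. by case: subF => _ _; apply. Qed.

Lemma subfield0 : F 0.
Proof. by rewrite -(subrr 1); apply: subfieldB subfield1 subfield1. Qed.

Lemma subfieldN x : F x -> F (- x).
Proof. by move=> Fx; rewrite -sub0r; apply: subfieldB subfield0 Fx. Qed.

Lemma subfieldD x y : F x -> F y -> F (x + y).
Proof. by move=> Fx Fy; rewrite -(opprK y); apply/subfieldB/subfieldN. Qed.

Lemma subfieldM x y : F x -> F y -> F (x * y).
Proof.
(* This also covers [y = 0], since the inverse of 0 is 0. *)
move=> Fx Fy; have -> : x * y = x / (1 / y) by rewrite div1r invrK.
by do 2![apply: subfield_div => //]; apply: subfield1.
Qed.

Lemma subfieldX x n : F x -> F (x ^+ n).
Proof.
move=> Fx; elim: n => [|n IHn]; first by rewrite expr0; apply: subfield1.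
by rewrite exprS; apply: subfieldM.
Qed.

Lemma subfield_nat n : F n%:R.
Proof.
elim: n => [|n IHn]; first exact: subfield0.
by rewrite -natr1; apply/subfieldD/subfield1.
Qed.

End Subfield.

(** * Generated subfields and adjunction *)

Lemma gen_subfield_sub (S : algC -> Prop) x : S x -> gen_subfield S x.
Proof. by move=> Sx F _; apply. Qed.

Lemma gen_subfield_subfield (S : algC -> Prop) : is_subfield (gen_subfield S).
Proof.
split=> [|x y Sx Sy|x y Sx Sy] F subF SF; first exact: subfield1.
- by apply: subfieldB; [|apply: Sx|apply: Sy].
- by apply: subfield_div; [|apply: Sx|apply: Sy].
Qed.

Lemma sub_adjoin (F : algC -> Prop) t x : F x -> adjoin F t x.
Proof. by move=> Fx; apply: gen_subfield_sub; left. Qed.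

Lemma mem_adjoin (F : algC -> Prop) t : adjoin F t t.
Proof. by apply: gen_subfield_sub; right. Qed.

Lemma adjoinS (F G : algC -> Prop) t x :
  (forall y, F y -> G y) -> adjoin F t x -> adjoin G t x.
Proof.
move=> FG; apply; first exact: gen_subfield_subfield.
by move=> y [/FG/sub_adjoin //|->]; apply: mem_adjoin.
Qed.

(** An inductive form of the indexed towers: arguments on towers become inductions on the last
    adjunction, and indices return only in [in_radical_extension_expressible]. *)
Inductive radical_extension (S : algC -> Prop) : (algC -> Prop) -> Prop :=
| RadicalBase : radical_extension S (gen_subfield S)
| RadicalStep F t n : (0 < n)%N -> radical_extension S F -> F (t ^+ n) ->
    radical_extension S (adjoin F t).

Definition in_radical_extension (S : algC -> Prop) (x : algC) : Prop :=
  exists2 F, radical_extension S F & F x.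

(** * The field of all radical elements over S and its closure under roots *)

Section RadicalClosure.
Variable S : algC -> Prop.

Lemma radical_extension_subfield F : radical_extension S F -> is_subfield F.
Proof. by case=> *; apply: gen_subfield_subfield. Qed.

Lemma radical_extension_base F x :
  radical_extension S F -> gen_subfield S x -> F x.
Proof.
by move=> radF Sx; elim: radF => // {}F t n _ _ Fx _; apply: sub_adjoin.
Qed.

(** The adjunctions that build [G] are replayed on top of [F]: a relation placing [t ^+ n] in a
    field persists in every larger field. *)
Lemma radical_extension_join F G :
  radical_extension S F -> radical_extension S G ->
  exists H, [/\ radical_extension S H,
                forall x, F x -> H x & forall x, G x -> H x].
Proof.
move=> radF; elim=> [|{}G t n n_gt0 radG [H [radH FH GH]] Gt].
  by exists F; split=> // x; apply: radical_extension_base.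
exists (adjoin H t); split=> [|x /FH Hx|x]; last exact: adjoinS.
  exact: RadicalStep (GH _ Gt).
exact: sub_adjoin.
Qed.

Lemma in_radical_extension_subfield : is_subfield (in_radical_extension S).
Proof.
split=> [|x y [F radF Fx] [G radG Gy]|x y [F radF Fx] [G radG Gy]].
- exists (gen_subfield S); first exact: RadicalBase.
  exact: (subfield1 (gen_subfield_subfield S)).
- have [H [radH FH GH]] := radical_extension_join radF radG.
  exists H => //; have subH := radical_extension_subfield radH.
  by apply: subfieldB; [|apply: FH|apply: GH].
- have [H [radH FH GH]] := radical_extension_join radF radG.
  exists H => //; have subH := radical_extension_subfield radH.
  by apply: subfield_div; [|apply: FH|apply: GH].
Qed.

Lemma in_radical_extension_gen x : S x -> in_radical_extension S x.
Proof.
by exists (gen_subfield S); [apply: RadicalBase|apply: gen_subfield_sub].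
Qed.

Lemma in_radical_extension_root x n :
  (0 < n)%N -> in_radical_extension S (x ^+ n) -> in_radical_extension S x.
Proof.
move=> n_gt0 [F radF Fxn]; exists (adjoin F x); last exact: mem_adjoin.
exact: RadicalStep n_gt0 radF Fxn.
Qed.

Lemma in_radical_extension_sqrt x :
  in_radical_extension S x -> in_radical_extension S (sqrtC x).
Proof.
by move=> Sx; apply: (@in_radical_extension_root _ 2); rewrite ?sqrtCK.
Qed.

End RadicalClosure.

(** Induction on the extension appends one field to the sequence. Fields are matched only up to
    pointwise equivalence, so [adjoinS] carries the adjunction over from [F] to [G m]. *)
Lemma in_radical_extension_expressible r s u x :
  in_radical_extension (fun z => [\/ z = r, z = s | z = u]) x ->
  expressible_by_radicals r s u x.
Proof.
case=> F radF.
suff [m [G [t [n [G0 GS GF]]]]] : exists (m : nat) (G : nat -> algC -> Prop)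
    (t : nat -> algC) (n : nat -> nat),
    [/\ forall y, G 0 y <-> gen_subfield (fun z => [\/ z = r, z = s | z = u]) y,
        forall i, (i < m)%N -> [/\ (1 <= n i)%N, G i (t i ^+ n i)
          & forall y, G i.+1 y <-> adjoin (G i) (t i) y]
      & forall y, F y <-> G m y].
  by move=> /GF Gx; exists m, G, t, n.
elim: radF => {F x} [|F t k k_gt0 _ [m [G [ts [n [G0 GS GF]]]]] Ft].
  (* A tower of height 0 puts no condition on [t] and [n], so their values are dummies. *)
  by exists 0%N, (fun=> gen_subfield (fun z => [\/ z = r, z = s | z = u])),
    (fun=> 0), (fun=> 0%N).
exists m.+1, (fun i => if (i <= m)%N then G i else adjoin F t),
  (fun i => if (i < m)%N then ts i else t),
  (fun i => if (i < m)%N then n i else k).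
split=> [//|i|y]; last by rewrite ltnn.
rewrite ltnS => le_im; rewrite le_im.
case: (ltngtP i m) le_im => // [lt_im|->] _; first exact: GS.
by split=> // [|y]; [apply/GF|split; apply: adjoinS => z /GF].
Qed.

(** Finds two radical elements with given sum and difference of squares and given product. Any
    square roots of the two halves have product [m] or [- m]; in the second case one root changes
    sign. *)
Lemma radical_square_pair S sigma delta m :
  in_radical_extension S sigma -> in_radical_extension S delta ->
  in_radical_extension S m -> 4 * m ^+ 2 = sigma ^+ 2 - delta ^+ 2 ->
  exists x y, [/\ in_radical_extension S x, in_radical_extension S y &
    [/\ x ^+ 2 = (sigma + delta) / 2, y ^+ 2 = (sigma - delta) / 2
      & x * y = m]].
Proof.
have subS := in_radical_extension_subfield S.
move=> Ss Sd Sm mE; pose x := sqrtC ((sigma + delta) / 2).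
pose y := sqrtC ((sigma - delta) / 2).
have xE : x ^+ 2 = (sigma + delta) / 2 by apply: sqrtCK.
have yE : y ^+ 2 = (sigma - delta) / 2 by apply: sqrtCK.
have S2 : in_radical_extension S 2 by apply: subfield_nat.
have Sx : in_radical_extension S x.
  by apply: in_radical_extension_sqrt; apply: subfield_div => //;
    apply: subfieldD.
have Sy : in_radical_extension S y.
  by apply: in_radical_extension_sqrt; apply: subfield_div => //;
    apply: subfieldB.
have : (x * y) ^+ 2 == m ^+ 2.
  have -> : m ^+ 2 = (sigma ^+ 2 - delta ^+ 2) / 4 by rewrite -mE; field.
  by apply/eqP; rewrite exprMn xE yE; field.
rewrite eqf_sqr => /orP[] /eqP xyE; first by exists x, y.
exists x, (- y); split=> //; first exact: subfieldN.
by rewrite sqrrN mulrN xyE opprK.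
Qed.

Theorem theorem4p1 (r s u : algC)
  (smooth_X4 : smooth_plane_curve (quartic_X4 r s u))
  (sqrt_disc sqrt_p sqrt_q sqrt_2 p q : algC)
  (sqrt_discE : sqrt_disc ^+ 2 = r ^+ 2 - 4)
  (sqrt_pE : sqrt_p ^+ 2 = - sqrt_disc - r)
  (sqrt_qE : sqrt_q ^+ 2 = sqrt_disc - r)
  (sqrt_2E : sqrt_2 ^+ 2 = 2)
  (pE : p = sqrt_p / sqrt_2)
  (qE : q = sqrt_q / sqrt_2)
  (pq1 : p * q = 1) :
  exists a b c d e f : algC,
    [/\ (b ^+ 2 - e ^+ 2) * (q + p) + (c ^+ 2 - d ^+ 2) * (q - p) = 0,
        a ^+ 2 * q ^+ 2 - b ^+ 2 + c ^+ 2 + d ^+ 2 - e ^+ 2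
          + f ^+ 2 * p ^+ 2 = s,
        f ^+ 2 + e ^+ 2 + d ^+ 2 + c ^+ 2 + b ^+ 2 + a ^+ 2 = - u,
        a * d * e * q - a * b * c * q + c * e * f * p - b * d * f * p = 0
      & c * e * f + b * d * f + a * d * e + a * b * c = 0 /\
        a ^+ 2 * f ^+ 2 - 2 * a * b * e * f - 2 * a * c * d * f
          + b ^+ 2 * e ^+ 2 - 2 * b * c * d * e + c ^+ 2 * d ^+ 2 = 1]
    /\ (forall x : algC, x \in [:: a; b; c; d; e; f] ->
          expressible_by_radicals r s u x).
Proof.
pose S z := [\/ z = r, z = s | z = u]; pose R := in_radical_extension S.
have subR : is_subfield R := in_radical_extension_subfield S.
have Rr : R r by apply: in_radical_extension_gen; apply: Or31.
have Rs : R s by apply: in_radical_extension_gen; apply: Or32.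
have Ru : R u by apply: in_radical_extension_gen; apply: Or33.
have Rn n : R n%:R by apply: subfield_nat.
have R1 : R 1 by apply: subfield1.
have RD x y : R x -> R y -> R (x + y) by apply: subfieldD.
have RB x y : R x -> R y -> R (x - y) by apply: subfieldB.
have RN x : R x -> R (- x) by apply: subfieldN.
have RM x y : R x -> R y -> R (x * y) by apply: subfieldM.
have RX x n : R x -> R (x ^+ n) by apply: subfieldX.
have Rdiv x y : R x -> R y -> R (x / y) by apply: subfield_div.
have Rsqrt x : R x -> R (sqrtC x) by apply: in_radical_extension_sqrt.
have Rroot2 x : R (x ^+ 2) -> R x by apply: in_radical_extension_root.
(* Membership in [R] depends only on the squares, so the choice of the roots defining [p] and [q]
   does not matter. *)
have Rdisc : R sqrt_disc by apply: Rroot2; rewrite sqrt_discE; auto.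
have Rp : R p.
  by rewrite pE; apply: Rdiv; apply: Rroot2; rewrite ?sqrt_pE ?sqrt_2E; auto.
have Rq : R q.
  by rewrite qE; apply: Rdiv; apply: Rroot2; rewrite ?sqrt_qE ?sqrt_2E; auto.
clear Rroot2.
have p2q2 : p ^+ 2 + q ^+ 2 = - r.
  by rewrite pE qE !expr_div_n sqrt_pE sqrt_qE sqrt_2E; field.
have qBp2 : (q - p) ^+ 2 = - r - 2.
  (* Writing 2 as 2pq turns the claim into a polynomial identity in p and q. *)
  by rewrite -p2q2 -[2 in RHS](mulr1 2) -[X in 2 * X]pq1; ring.
have qDp2 : (q + p) ^+ 2 = 2 - r.
  by rewrite -[r]opprK -p2q2 -[2 in RHS](mulr1 2) -[X in 2 * X]pq1; ring.
(* The coefficients come from putting 2m = 1 + su/4 + w into 4m^2 = (s + u)^2/4 + (r + 2)w, where w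
   = k^2 and m = be. *)
pose beta := s * u / 2 - r.
pose gamma := (1 + s * u / 4) ^+ 2 - (s + u) ^+ 2 / 4.
pose w := (sqrtC (beta ^+ 2 - 4 * gamma) - beta) / 2; pose k := sqrtC w.
have wE : w ^+ 2 + beta * w + gamma = 0.
  have := sqrtCK (beta ^+ 2 - 4 * gamma); set h := sqrtC _ => hE.
  have -> : gamma = (beta ^+ 2 - h ^+ 2) / 4 by rewrite hE; field.
  by rewrite /w -/h; field.
have kE : k ^+ 2 = w by apply: sqrtCK.
have Rbeta : R beta by rewrite /beta; auto.
have Rgamma : R gamma by rewrite /gamma; auto 8.
have Rw : R w by rewrite /w; auto 8.
have Rk : R k by rewrite /k; auto.
pose m := (1 + s * u / 4 + w) / 2.
have Rm : R m by rewrite /m; auto 6.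
have mE : 4 * m ^+ 2 = (- (s + u) / 2) ^+ 2 - ((q - p) * k) ^+ 2.
  rewrite [((q - p) * k) ^+ 2]exprMn qBp2 kE.
  (* The difference of the two sides is exactly the quadratic polynomial that vanishes at [w]; the
     same holds in [mE']. *)
  apply/eqP; rewrite -subr_eq0 -wE; apply/eqP.
  by rewrite /m /beta /gamma; field.
have mE' : 4 * (m - 1) ^+ 2 = ((s - u) / 2) ^+ 2 - (- (q + p) * k) ^+ 2.
  rewrite [(- (q + p) * k) ^+ 2]exprMn sqrrN qDp2 kE.
  apply/eqP; rewrite -subr_eq0 -wE; apply/eqP.
  by rewrite /m /beta /gamma; field.
(* The second and third equations amount to b^2 + e^2 = -(s + u)/2 and c^2 + d^2 = (s - u)/2, the
   values of [sigma] in the two calls. *)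
have [||b [e [Rb Re [b2 e2 beE]]]] := @radical_square_pair S _ _ _ _ _ Rm mE.
- by apply: Rdiv; auto.
- by apply: RM; auto.
have [|||c [d [Rc Rd [c2 d2 cdE]]]] := @radical_square_pair S _ _ _ _ _ _ mE'.
- by apply: Rdiv; auto.
- by apply: RM; auto.
- by apply: RB; auto.
exists 0, b, c, d, e, 0; split; last first.
  have R0 : R 0 by apply: (Rn 0).
  move=> x x_in; apply: in_radical_extension_expressible; move: x_in.
  by rewrite !inE => /or4P[||| /or3P[]] /eqP->.
split; try by rewrite b2 e2 c2 d2; field.
  by ring.
split; first by ring.
(* Here be - cd = m - (m - 1) = 1. *)
transitivity ((b * e - c * d) ^+ 2); first by ring.
by rewrite beE cdE; ring.
Qed.
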